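(* Let $n\ge 1$ and let $\mathcal{T}$ be a track $n$-category. Then $\mathcal{T}$ is abelian if and only if it is linear; that is, the groups $\mathrm{Aut}^{\mathcal{T}}_u$ are abelian for all $(n-1)$-cells $u$ of $\mathcal{T}$ if and only if there exists an abelian natural system $\Pi(\mathcal{T})$ on the $(n-1)$-category $\overline{\mathcal{T}}$ such that the natural system $\widehat{\Pi(\mathcal{T})}$ on $\mathcal{T}_{n-1}$ is isomorphic to $\mathrm{Aut}^{\mathcal{T}}$.
   Context: Categories are strict. In an $n$-category $\mathcal{C}$, $\mathcal{C}_k$ denotes the set (and the $k$-category) of $k$-cells, $s_i,t_i$ are the $i$-source and $i$-target maps ($s,t$ denote $s_{k-1},t_{k-1}$ on $k$-cells), and $f\star_i g$ is the $i$-composite, defined when $t_i(f)=s_i(g)$. A $k$-sphere is a pair of parallel $k$-cells (same source and same target). A $k$-cell $f$ with $s(f)=t(f)=u$ is called closed with base $u$. Contexts: a context of an $m$-category $\mathcal{C}$ is a pair $(x,C)$ where $x$ is an $(m-1)$-sphere of $\mathcal{C}$ and $C$ is an $m$-cell of $\mathcal{C}[x]$ (the $m$-category obtained from $\mathcal{C}$ by freely adjoining an $m$-cell $x$ with the given boundary) containing exactly one occurrence of $x$. For an $m$-cell $f$ parallel to $x$, $C[f]$ is obtained by replacing $x$ by $f$. Every context can be written $C=f_m\star_{m-1}(f_{m-1}\star_{m-2}(\cdots\star_1 f_1\star_0 x\star_0 g_1\star_1\cdots)\star_{m-2}g_{m-1})\star_{m-1}g_m$, with $f_k,g_k$ $k$-cells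 of $\mathcal{C}$. The category of contexts $\mathbf{C}\mathcal{C}$ has the $m$-cells of $\mathcal{C}$ as objects and, as morphisms from $f$ to $g$, the contexts $C$ with $C[f]=g$. A natural system on $\mathcal{C}$ is a functor $D$ from $\mathbf{C}\mathcal{C}$ to groups, with values written $D_u$, $D_C$; it is abelian if every $D_u$ is abelian. A track $n$-category is an $n$-category $\mathcal{T}$ all of whose $n$-cells are invertible (for $\star_{n-1}$). The $(n-1)$-category presented by $\mathcal{T}$ is $\overline{\mathcal{T}}=\mathcal{T}_{n-1}/\mathcal{T}_n$, the quotient of $\mathcal{T}_{n-1}$ identifying $s(f)$ and $t(f)$ for every $n$-cell $f$; $\overline{u}$ and $\overline{C}$ denote the images in $\overline{\mathcal{T}}$ of an $(n-1)$-cell $u$ and of a context $C$ of $\mathcal{T}_{n-1}$. For an $(n-1)$-cell $u$, $\mathrm{Aut}^{\mathcal{T}}_u$ is the group, under $\star_{n-1}$, of closed $n$-cells of $\mathcal{T}$ with base $u$. This extends to a natural system $\mathrm{Aut}^{\mathcal{T}}$ on $\mathcal{T}_{n-1}$, a context $C$ of $\mathcal{T}_{n-1}$ acting by $f\mapsto C[f]$ (whiskering). $\mathcal{T}$ is abelian when every $\mathrm{Aut}^{\mathcal{T}}_u$ is abelian. For a natural system $D$ on $\overline{\mathcal{T}}$, $\widehat{D}$ is the natural system on $\mathcal{T}_{n-1}$ with $\widehat{D}_u=D_{\overline{u}}$ (and $\widehat{D}_C=D_{\overline{C}}$). $\mathcal{T}$ is linear when there is an abelian natural system $\Pi(\mathcal{T})$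 on $\overline{\mathcal{T}}$ such that $\widehat{\Pi(\mathcal{T})}$ is isomorphic to $\mathrm{Aut}^{\mathcal{T}}$. *)

(* Defs.v *)
From HB Require Import structures.
From mathcomp Require Import all_boot.
From mathcomp Require Import generic_quotient zify boolp.

Set Implicit Arguments.
Unset Strict Implicit.
Unset Printing Implicit Defensive.
Set Warnings "-redundant-canonical-projection".

Local Open Scope quotient_scope.

Record equivalence (A : Type) := Equivalence {
  equiv_fun :> A -> A -> Prop;
  equiv_refl : forall a, equiv_fun a a;
  equiv_sym : forall a b, equiv_fun a b -> equiv_fun b a;
  equiv_trans : forall a b c, equiv_fun a b -> equiv_fun b c -> equiv_fun a c }.

Lemma sval_inj A (P : A -> Prop) (u v : {a | P a}) : sval u = sval v -> u = v.
Proof. by case: u v => [a ?] [b ?] /= ab; apply: eq_exist. Qed.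

Section Quotient.
Variables (A : Type) (R : equivalence A).

Let boolR (a b : {classic A}) : bool := `[< R a b >].

Fact boolR_refl : reflexive boolR.
Proof. by move=> a; apply/asboolP; apply: equiv_refl. Qed.

Fact boolR_sym : symmetric boolR.
Proof.
by move=> a b; apply/idP/idP => /asboolP ab; apply/asboolP; apply: equiv_sym.
Qed.

Fact boolR_trans : transitive boolR.
Proof.
by move=> b a c /asboolP ab /asboolP bc; apply/asboolP; apply: equiv_trans bc.
Qed.

Definition boolR_equiv := EquivRel boolR boolR_refl boolR_sym boolR_trans.

Definition quot : Type := {eq_quot boolR_equiv}.
Definition cls (a : A) : quot := (\pi_{eq_quot boolR_equiv} (a : {classic A})).
Definition rep (q : quot) : A := repr (q : {eq_quot boolR_equiv}).

Lemma repK q : cls (rep q) = q.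
Proof. exact: reprK. Qed.

Lemma clsP a b : cls a = cls b <-> R a b.
Proof.
split=> [/(@eqmodP _ boolR_equiv a b) /asboolP //|Rab].
by apply/(@eqmodP _ boolR_equiv a b)/asboolP.
Qed.

Lemma rep_cls a : R (rep (cls a)) a.
Proof. by apply/clsP; rewrite repK. Qed.

End Quotient.

(* [src i f] is s_i(f), [tgt i f] is t_i(f) (for i <= k), [one j f] is the
   iterated identity j-cell on f (for k <= j) and [comp i f g] is the
   i-composite of f and g in diagrammatic order (for i < k and
   t_i(f) = s_i(g)).  The operations are total, but nothing is assumed about
   their values outside these ranges, nor, in an n-category, about cells of
   dimension > n: these carry no information and are never used. *)
Record globular := Globular {
  cell : nat -> Type;
  src : forall k i, cell k -> cell i;
  tgt : forall k i, cell k -> cell i;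
  one : forall k j, cell k -> cell j;
  comp : forall k, nat -> cell k -> cell k -> cell k }.

Arguments cell : clear implicits.
Arguments src {g k} i f.
Arguments tgt {g k} i f.
Arguments one {g k} j f.
Arguments comp {g k} i f g0.

Record is_ncat (n : nat) (G : globular) : Prop := IsNCat {
  srcK : forall k (f : cell G k), k <= n -> src k f = f;
  tgtK : forall k (f : cell G k), k <= n -> tgt k f = f;
  src_src : forall k i j (f : cell G k), i < j <= k -> k <= n ->
    src i (src j f) = src i f;
  src_tgt : forall k i j (f : cell G k), i < j <= k -> k <= n ->
    src i (tgt j f) = src i f;
  tgt_src : forall k i j (f : cell G k), i < j <= k -> k <= n ->
    tgt i (src j f) = tgt i f;
  tgt_tgt : forall k i j (f : cell G k), i < j <= k -> k <= n ->
    tgt i (tgt j f) = tgt i f;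
  oneK : forall k (f : cell G k), k <= n -> one k f = f;
  one_one : forall k j l (f : cell G k), k <= j <= l -> l <= n ->
    one l (one j f) = one l f;
  src_one : forall k j (f : cell G k), k <= j <= n -> src k (one j f) = f;
  tgt_one : forall k j (f : cell G k), k <= j <= n -> tgt k (one j f) = f;
  src_comp : forall k i (f g : cell G k), i < k <= n -> tgt i f = src i g ->
    src i (comp i f g) = src i f;
  tgt_comp : forall k i (f g : cell G k), i < k <= n -> tgt i f = src i g ->
    tgt i (comp i f g) = tgt i g;
  src_comp_gt : forall k i j (f g : cell G k), i < j <= k -> k <= n ->
    tgt i f = src i g -> src j (comp i f g) = comp i (src j f) (src j g);
  tgt_comp_gt : forall k i j (f g : cell G k), i < j <= k -> k <= n ->
    tgt i f = src i g -> tgt j (comp i f g) = comp i (tgt j f) (tgt j g);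
  comp1l : forall k i (f : cell G k), i < k <= n ->
    comp i (one k (src i f)) f = f;
  comp1r : forall k i (f : cell G k), i < k <= n ->
    comp i f (one k (tgt i f)) = f;
  one_comp : forall k i j (f g : cell G k), i < k <= j -> j <= n ->
    tgt i f = src i g -> one j (comp i f g) = comp i (one j f) (one j g);
  compA : forall k i (f g h : cell G k), i < k <= n ->
    tgt i f = src i g -> tgt i g = src i h ->
    comp i (comp i f g) h = comp i f (comp i g h);
  exchange : forall k i j (f g h l : cell G k), i < j < k -> k <= n ->
    tgt i f = src i g -> tgt i h = src i l ->
    tgt j f = src j h -> tgt j g = src j l ->
    comp j (comp i f g) (comp i h l) = comp i (comp j f h) (comp j g l) }.

Record ncat (n : nat) := NCat {
  ncat_data :> globular;
  ncatP : is_ncat n ncat_data }.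


Fact trunc_subproof n (T : ncat n.+1) : is_ncat n T.
Proof.
by case: T => T [] *; split=> *;
  match goal with H : _ |- _ => eapply H; eauto; lia end.
Qed.

(* The n-category of k-cells, k <= n, of an (n+1)-category. *)
Definition trunc n (T : ncat n.+1) : ncat n := NCat (trunc_subproof T).

Section Boundaries.
Variable G : globular.

(* The boundary of an m-cell is a pair of (m-1)-cells; a 0-cell has the empty
   boundary, so that there is exactly one (-1)-sphere. *)
Definition bdry_data (m : nat) : Type :=
  if m is p.+1 then (cell G p * cell G p)%type else unit.

Definition bdry (m k : nat) : cell G k -> bdry_data m :=
  match m return cell G k -> bdry_data m with
  | 0 => fun=> tt
  | p.+1 => fun f => (src p f, tgt p f)
  end.

Definition parallel (p : nat) (a b : cell G p) : Prop := bdry p a = bdry p b.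

Definition is_sphere (m : nat) : bdry_data m -> Prop :=
  match m return bdry_data m -> Prop with
  | 0 => fun=> True
  | p.+1 => fun x => parallel x.1 x.2
  end.

(* (m-1)-spheres *)
Definition sphere (m : nat) : Type := {x : bdry_data m | is_sphere x}.

Definition composable (m i : nat) : bdry_data m -> bdry_data m -> Prop :=
  match m return bdry_data m -> bdry_data m -> Prop with
  | 0 => fun _ _ => False
  | p.+1 => fun x y => i <= p /\ tgt i x.2 = src i y.1
  end.

Definition comp_bdry (m i : nat) : bdry_data m -> bdry_data m -> bdry_data m :=
  match m return bdry_data m -> bdry_data m -> bdry_data m with
  | 0 => fun x _ => x
  | p.+1 => fun x y =>
      if i == p then (x.1, y.2) else (comp i x.1 y.1, comp i x.2 y.2)
  end.

(* Formal composites of m-cells of G and of an indeterminate m-cell x, written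
   Var; whether the composites are defined is imposed by [wf] below. *)
Inductive expr (m : nat) : Type :=
| Cell of cell G m
| Var
| Comp of nat & expr m & expr m.

Fixpoint occ m (t : expr m) : nat :=
  match t with
  | Cell _ => 0
  | Var => 1
  | Comp _ t1 t2 => occ t1 + occ t2
  end.

Fixpoint subst m (t' t : expr m) : expr m :=
  match t' with
  | Cell c => Cell c
  | Var => t
  | Comp i t1 t2 => Comp i (subst t1 t) (subst t2 t)
  end.

(* Replace x by a k-cell f with k >= m, the m-cells of G being read as
   identity k-cells: for k = m this is C[f], for k = m+1 whiskering. *)
Fixpoint ev m k (t : expr m) (f : cell G k) : cell G k :=
  match t with
  | Cell c => one k c
  | Var => f
  | Comp i t1 t2 => comp i (ev t1 f) (ev t2 f)
  end.

Section Typed.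
Variables (m : nat) (x : bdry_data m).

Fixpoint ebdry (t : expr m) : bdry_data m :=
  match t with
  | Cell c => bdry m c
  | Var => x
  | Comp i t1 t2 => comp_bdry i (ebdry t1) (ebdry t2)
  end.

Fixpoint wf (t : expr m) : Prop :=
  if t is Comp i t1 t2 then
    [/\ wf t1, wf t2 & composable i (ebdry t1) (ebdry t2)]
  else True.

(* The congruence on formal composites generated by the axioms of
   m-categories and by the composition of G.  In the unit rules, c is an i-cell
   and well-formedness forces it to be s_i(t), respectively t_i(t). *)
Inductive eqv : expr m -> expr m -> Prop :=
| eqv_refl t : eqv t t
| eqv_sym t1 t2 : eqv t1 t2 -> eqv t2 t1
| eqv_trans t1 t2 t3 : eqv t1 t2 -> eqv t2 t3 -> eqv t1 t3
| eqv_comp i t1 t2 u1 u2 : eqv t1 u1 -> eqv t2 u2 ->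
    eqv (Comp i t1 t2) (Comp i u1 u2)
| eqv_cell i (c d : cell G m) : wf (Comp i (Cell c) (Cell d)) ->
    eqv (Comp i (Cell c) (Cell d)) (Cell (comp i c d))
| eqv_1l i (c : cell G i) t : wf (Comp i (Cell (one m c)) t) ->
    eqv (Comp i (Cell (one m c)) t) t
| eqv_1r i (c : cell G i) t : wf (Comp i t (Cell (one m c))) ->
    eqv (Comp i t (Cell (one m c))) t
| eqv_assoc i t1 t2 t3 :
    wf (Comp i (Comp i t1 t2) t3) -> wf (Comp i t1 (Comp i t2 t3)) ->
    eqv (Comp i (Comp i t1 t2) t3) (Comp i t1 (Comp i t2 t3))
| eqv_exch i j t1 t2 t3 t4 : i < j ->
    wf (Comp j (Comp i t1 t2) (Comp i t3 t4)) ->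
    wf (Comp i (Comp j t1 t3) (Comp j t2 t4)) ->
    eqv (Comp j (Comp i t1 t2) (Comp i t3 t4))
        (Comp i (Comp j t1 t3) (Comp j t2 t4)).

Definition wf_eqv : equivalence {t | wf t} :=
  @Equivalence {t | wf t} (fun t u => eqv (sval t) (sval u))
    (fun t => eqv_refl (sval t))
    (fun t u => @eqv_sym (sval t) (sval u))
    (fun t u v => @eqv_trans (sval t) (sval u) (sval v)).

Lemma eqv_occ t u : eqv t u -> occ t = occ u.
Proof.
by elim=> {t u} *; rewrite /=; lia.
Qed.

End Typed.
End Boundaries.

Lemma ebdry_subst (G : globular) m (x y : bdry_data G m) (t' t : expr G m) :
  ebdry x t = y -> ebdry x (subst t' t) = ebdry y t'.
Proof. by move=> ty; elim: t' => //= i t1 -> t2 ->. Qed.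

Lemma wf_subst (G : globular) m (x y : bdry_data G m) (t' t : expr G m) :
  ebdry x t = y -> wf x t -> wf y t' -> wf x (subst t' t).
Proof.
move=> ty wt; elim: t' => //= i t1 IH1 t2 IH2 [/IH1 w1 /IH2 w2].
by rewrite -!(ebdry_subst _ ty).
Qed.

Lemma occ_subst (G : globular) m (t' t : expr G m) :
  occ (subst t' t) = occ t' * occ t.
Proof. by elim: t' => //= [|i t1 -> t2 ->]; rewrite ?mul1n ?mulnDl. Qed.

Lemma ev_subst (G : globular) m k (t' t : expr G m) (f : cell G k) :
  ev (subst t' t) f = ev t' (ev t f).
Proof. by elim: t' => //= i t1 -> t2 ->. Qed.

Lemma eqv_substl (G : globular) m (x : bdry_data G m) (t' t u : expr G m) :
  eqv x t u -> eqv x (subst t' t) (subst t' u).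
Proof.
move=> tu; elim: t' => //= [c|i t1 IH1 t2 IH2]; first exact: eqv_refl.
exact: eqv_comp.
Qed.

Lemma eqv_substr (G : globular) m (x y : bdry_data G m) (t' u' t : expr G m) :
  ebdry x t = y -> wf x t -> eqv y t' u' -> eqv x (subst t' t) (subst u' t).
Proof.
move=> ty wt; have w := wf_subst ty wt.
elim=> {t' u'} [u|u v _|u v z _ + _|i u v u' v' _ + _|i c d|i c u|i c u
  |i u v z|i j u1 u2 u3 u4 ij].
- exact: eqv_refl.
- exact: eqv_sym.
- exact: eqv_trans.
- exact: eqv_comp.
- by move=> /w; apply: eqv_cell.
- by move=> /w; apply: eqv_1l.
- by move=> /w; apply: eqv_1r.
- by move=> /w ? /w ?; apply: eqv_assoc.
- by move=> /w ? /w ?; apply: eqv_exch.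
Qed.

(* m-cells of the m-category obtained from C by adjoining an m-cell x with the
   given boundary; its cells of dimension < m are those of C. *)
Definition adj m (C : ncat m) (x : sphere C m) : Type :=
  quot (wf_eqv (sval x)).

Definition occurrences m (C : ncat m) (x : sphere C m) (c : adj x) : nat :=
  occ (sval (rep c)).

Definition context m (C : ncat m) (x : sphere C m) : Type :=
  {c : adj x | occurrences c = 1}.

Section NCat.
Variables (n : nat) (G : globular) (GP : is_ncat n G).

Lemma bdry_sphere m k (f : cell G k) : m <= k -> k <= n -> is_sphere (bdry m f).
Proof.
case: m => //= p pk kn; rewrite /parallel; case: p pk => //= p pk.
have h : p < p.+1 <= k by lia.
by rewrite (src_src GP) // (src_tgt GP) // (tgt_src GP) // (tgt_tgt GP).
Qed.

Lemma composableP m k i (f g : cell G k) : m <= k -> k <= n ->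
  composable i (bdry m f) (bdry m g) <-> i < m /\ tgt i f = src i g.
Proof.
case: m => [|p] mk kn /=; first by split=> // -[].
rewrite ltnS leq_eqVlt; case: eqP => [->|_] /=.
  by rewrite (tgtK GP) ?(srcK GP) //; lia.
case: (ltnP i p) => [ip|pcls]; last by split=> -[].
by rewrite (tgt_tgt GP) ?(src_src GP) ?ip // ltnW.
Qed.

Lemma bdry_comp m k i (f g : cell G k) : i < m -> m <= k -> k <= n ->
  tgt i f = src i g -> bdry m (comp i f g) = comp_bdry i (bdry m f) (bdry m g).
Proof.
case: m => //= p ip pk kn fg; case: eqP => [ip'|/eqP ip'].
  by subst p; rewrite (src_comp GP) ?pk // (tgt_comp GP) ?pk.
by rewrite (src_comp_gt GP) ?(tgt_comp_gt GP) //; lia.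
Qed.

Lemma bdry_one m k (c : cell G m) : m <= k -> k <= n ->
  bdry m (one k c) = bdry m c.
Proof.
case: m c => //= p c pk kn.
rewrite -(src_src GP (one k c) (i := p) (j := p.+1)) ?ltnSn //.
rewrite -(tgt_tgt GP (one k c) (i := p) (j := p.+1)) ?ltnSn //.
by rewrite (src_one GP) ?(tgt_one GP) ?pk.
Qed.

Section Ev.
Variables (m k : nat) (mk : m <= k) (kn : k <= n).
Variables (x : bdry_data G m) (f : cell G k) (fx : bdry m f = x).

Lemma bdry_ev (t : expr G m) : wf x t -> bdry m (ev t f) = ebdry x t.
Proof.
elim: t => [c|//|i t1 IH1 t2 IH2] /=; first by rewrite bdry_one.
move=> [/IH1 {}IH1 /IH2 {}IH2]; rewrite -IH1 -IH2.
by move=> /(composableP _ _ _ mk kn)[im e]; rewrite bdry_comp.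
Qed.

Lemma wf_comp i (t1 t2 : expr G m) : wf x (Comp i t1 t2) <->
  [/\ wf x t1, wf x t2, i < m & tgt i (ev t1 f) = src i (ev t2 f)].
Proof.
split=> /=.
  move=> [w1 w2]; rewrite -!bdry_ev //.
  by move=> /(composableP _ _ _ mk kn)[].
by move=> [w1 w2 im e]; split=> //; rewrite -!bdry_ev //; apply/composableP.
Qed.

Lemma eqv_ev (t u : expr G m) : eqv x t u ->
  (wf x t <-> wf x u) /\ (wf x t -> ev t f = ev u f).
Proof.
elim=> {t u} [t|t u _ [wtu etu]|t u v _ [wtu etu] _ [wuv euv]
  |i t1 t2 u1 u2 _ [w1 e1] _ [w2 e2]|i c d w|i c t w|i c t w|i t1 t2 t3 w w'
  |i j t1 t2 t3 t4 ij w w'].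
- by [].
- by split=> [|/wtu /etu ->]; first exact: iff_sym.
- by split=> [|wt]; [exact: iff_trans wuv|rewrite etu // euv //; apply/wtu].
- split; last by move=> /= [/e1 -> /e2 ->].
  rewrite !wf_comp; split=> [[a b im]|[/w1 a /w2 b im]].
    by rewrite e1 // e2 //; split=> //; [apply/w1|apply/w2].
  by rewrite e1 // e2.
- split=> //= _; move/wf_comp: w => /= [_ _ im].
  rewrite -(tgt_tgt GP (one k c) (i := i) (j := m)) ?im //.
  rewrite -(src_src GP (one k d) (i := i) (j := m)) ?im //.
  rewrite (tgt_one GP) ?(src_one GP) ?mk // => e.
  by rewrite (one_comp GP) ?im.
- move/wf_comp: (w) => /= [_ wt im].
  rewrite (one_one GP) ?(ltnW im) //  (tgt_one GP) ?(leq_trans (ltnW im)) //.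
  move=> e; split=> [|_]; first by split=> _; [exact: wt|exact: w].
  by rewrite e (comp1l GP) // (leq_trans im).
- move/wf_comp: (w) => /= [wt _ im].
  rewrite (one_one GP) ?(ltnW im) //  (src_one GP) ?(leq_trans (ltnW im)) //.
  move=> e; split=> [|_]; first by split=> _; [exact: wt|exact: w].
  by rewrite -e (comp1r GP) // (leq_trans im).
- split=> [//|_ /=]; move/wf_comp: w => [/wf_comp[_ _ im e] _ _ /=].
  have ik : i < k <= n by rewrite (leq_trans im).
  by rewrite (tgt_comp GP) // => e'; rewrite (compA GP).
- split=> [//|_ /=]; move/wf_comp: w => [/wf_comp[_ _ im e]].
  move=> /wf_comp[_ _ _ e'] jm _; move/wf_comp: w'.
  move=> [/wf_comp[_ _ _ e1] /wf_comp[_ _ _ e2] _ _].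
  by rewrite (exchange GP) // ij (leq_trans jm).
Qed.

End Ev.

Section Whisker.
Variables (m : nat) (mn : m < n) (x : bdry_data G m).

Lemma src_ev (t : expr G m) (f : cell G m.+1) : bdry m f = x -> wf x t ->
  src m (ev t f) = ev t (src m f).
Proof.
move=> fx; elim: t => [c|//|i t1 IH1 t2 IH2].
  by move=> _ /=; rewrite (src_one GP) ?leqnSn ?(oneK GP) // ltnW.
move=> /(wf_comp (leqnSn m) mn fx)[w1 w2 im e] /=.
by rewrite (src_comp_gt GP) ?im ?leqnSn // IH1 // IH2.
Qed.

Lemma tgt_ev (t : expr G m) (f : cell G m.+1) : bdry m f = x -> wf x t ->
  tgt m (ev t f) = ev t (tgt m f).
Proof.
move=> fx; elim: t => [c|//|i t1 IH1 t2 IH2].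
  by move=> _ /=; rewrite (tgt_one GP) ?leqnSn ?(oneK GP) // ltnW.
move=> /(wf_comp (leqnSn m) mn fx)[w1 w2 im e] /=.
by rewrite (tgt_comp_gt GP) ?im ?leqnSn // IH1 // IH2.
Qed.

Lemma ev_comp (t : expr G m) (f g : cell G m.+1) : bdry m f = x ->
  bdry m g = x -> tgt m f = src m g -> wf x t ->
  ev t (comp m f g) = comp m (ev t f) (ev t g).
Proof.
move=> fx gx fg; elim: t => [c|//|i t1 IH1 t2 IH2].
  move=> _ /=; have h : m <= m.+1 <= n by rewrite leqnSn.
  by rewrite -{2}(src_one GP c h) (comp1l GP) ?(src_one GP) ?ltnSn.
move=> w; move/(wf_comp (leqnSn m) mn fx): (w) => [w1 w2 im e] /=.
move/(wf_comp (leqnSn m) mn gx): w => [_ _ _ e'] /=.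
rewrite IH1 // IH2 // -(exchange GP) ?im ?ltnSn //;
  by rewrite tgt_ev // src_ev // fg.
Qed.

End Whisker.
End NCat.

Definition boundary m (C : ncat m) (f : cell C m) : sphere C m :=
  exist _ (bdry m f) (bdry_sphere (ncatP C) f (leqnn m) (leqnn m)).

(* C[f] for an m-cell f parallel to x *)
Definition fill m (C : ncat m) (x : sphere C m) (c : context x)
  (f : cell C m) : cell C m := ev (sval (rep (sval c))) f.

(* Morphisms from f to g in the category of contexts: since C[f] only makes
   sense for x parallel to f, the sphere of the context is the boundary of f. *)
Definition hom m (C : ncat m) (f g : cell C m) : Type :=
  {c : context (boundary f) | fill c f = g}.

Section ContextCategory.
Variables (m : nat) (C : ncat m).
Implicit Types (f g h : cell C m).

Definition hom_expr f g (c : hom f g) : expr C m := sval (rep (sval (sval c))).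

Lemma hom_wf f g (c : hom f g) : wf (bdry m f) (hom_expr c).
Proof. exact: svalP (rep (sval (sval c))). Qed.

Lemma hom_occ f g (c : hom f g) : occ (hom_expr c) = 1.
Proof. exact: svalP (sval c). Qed.

Lemma hom_ev f g (c : hom f g) : ev (hom_expr c) f = g.
Proof. exact: svalP c. Qed.

Lemma hom_bdry f g (c : hom f g) : ebdry (bdry m f) (hom_expr c) = bdry m g.
Proof.
by rewrite -(bdry_ev (ncatP C) _ _ (erefl (bdry m f)) (hom_wf c)) // hom_ev.
Qed.

Section MkHom.
Variables (f g : cell C m) (t : expr C m).
Hypotheses (wt : wf (bdry m f) t) (ot : occ t = 1) (et : ev t f = g).

Let q : adj (boundary f) := cls (wf_eqv (bdry m f)) (exist _ t wt).

Fact mk_hom_eqv : eqv (bdry m f) (sval (rep q)) t.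
Proof. exact: (rep_cls (wf_eqv (bdry m f)) (exist _ t wt)). Qed.

Fact mk_hom_occ : occurrences q = 1.
Proof. by rewrite /occurrences (eqv_occ mk_hom_eqv). Qed.

Fact mk_hom_fill : fill (exist _ q mk_hom_occ) f = g.
Proof.
have [_ e] := eqv_ev (ncatP C) (leqnn m) (leqnn m) (erefl (bdry m f)) mk_hom_eqv.
by rewrite /fill /= e //; apply: svalP (rep q).
Qed.

Definition mk_hom : hom f g := exist _ (exist _ q mk_hom_occ) mk_hom_fill.

Lemma mk_homE : eqv (bdry m f) (hom_expr mk_hom) t.
Proof. exact: mk_hom_eqv. Qed.

End MkHom.

Lemma hom_eqP f g (c d : hom f g) :
  eqv (bdry m f) (hom_expr c) (hom_expr d) -> c = d.
Proof.
move=> cd; apply: sval_inj; apply: sval_inj.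
rewrite -[LHS]repK -[RHS]repK; apply/clsP; exact: cd.
Qed.

Definition hom_id f : hom f f :=
  @mk_hom f f (Var _ _) I (erefl 1) (erefl f).

Lemma hom_idE f : eqv (bdry m f) (hom_expr (hom_id f)) (Var _ _).
Proof. exact: mk_homE. Qed.

Section Comp.
Variables (f g h : cell C m) (c : hom f g) (d : hom g h).

Fact hom_comp_wf : wf (bdry m f) (subst (hom_expr d) (hom_expr c)).
Proof. exact: wf_subst (hom_bdry c) (hom_wf c) (hom_wf d). Qed.

Fact hom_comp_occ : occ (subst (hom_expr d) (hom_expr c)) = 1.
Proof. by rewrite occ_subst !hom_occ. Qed.

Fact hom_comp_ev : ev (subst (hom_expr d) (hom_expr c)) f = h.
Proof. by rewrite ev_subst !hom_ev. Qed.

(* d o c is obtained by substituting c for the indeterminate of d. *)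
Definition hom_comp : hom f h := mk_hom hom_comp_wf hom_comp_occ hom_comp_ev.

Lemma hom_compE :
  eqv (bdry m f) (hom_expr hom_comp) (subst (hom_expr d) (hom_expr c)).
Proof. exact: mk_homE. Qed.

End Comp.

Lemma hom_comp_idl f g (c : hom f g) : hom_comp (hom_id f) c = c.
Proof.
apply: hom_eqP; apply: eqv_trans (hom_compE _ _) _.
apply: eqv_trans (eqv_substl _ (hom_idE f)) _.
suff -> : subst (hom_expr c) (Var C m) = hom_expr c by apply: eqv_refl.
by elim: (hom_expr c) => //= i t1 -> t2 ->.
Qed.

Lemma hom_comp_idr f g (c : hom f g) : hom_comp c (hom_id g) = c.
Proof.
apply: hom_eqP; apply: eqv_trans (hom_compE _ _) _.
exact: eqv_substr (hom_bdry c) (hom_wf c) (hom_idE g).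
Qed.

Lemma hom_compA f g h l (c : hom f g) (d : hom g h) (e : hom h l) :
  hom_comp c (hom_comp d e) = hom_comp (hom_comp c d) e.
Proof.
apply: hom_eqP; apply: eqv_trans (hom_compE _ _) _.
apply: eqv_trans (eqv_substr (hom_bdry c) (hom_wf c) (hom_compE d e)) _.
apply: eqv_trans (eqv_sym (hom_compE _ _)).
apply: eqv_trans (eqv_sym (eqv_substl _ (hom_compE c d))).
suff -> : forall t, subst (subst t (hom_expr d)) (hom_expr c)
  = subst t (subst (hom_expr d) (hom_expr c)) by apply: eqv_refl.
by elim=> //= i t1 -> t2 ->.
Qed.

End ContextCategory.

Record natural_system m (C : ncat m) := NaturalSystem {
  ns_group :> cell C m -> groupType;
  ns_map : forall f g, hom f g -> {multiplicative ns_group f -> ns_group g};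
  ns_map_id : forall f (a : ns_group f), ns_map (hom_id f) a = a;
  ns_map_comp : forall f g h (c : hom f g) (d : hom g h) (a : ns_group f),
    ns_map (hom_comp c d) a = ns_map d (ns_map c a) }.

Definition abelian_group (G : groupType) : Prop := forall a b : G, commute a b.

Definition abelian_natural_system m (C : ncat m) (D : natural_system C) : Prop :=
  forall f, abelian_group (D f).

Record ns_iso m (C : ncat m) (D E : natural_system C) := NsIso {
  ns_iso_map :> forall f, {multiplicative D f -> E f};
  ns_iso_bij : forall f, bijective (ns_iso_map f);
  ns_iso_natural : forall f g (c : hom f g) (a : D f),
    ns_iso_map g (ns_map D c a) = ns_map E c (ns_iso_map f a) }.

Record functor m (C D : ncat m) := Functor {
  fcell :> forall k, cell C k -> cell D k;
  fsrc : forall k i (f : cell C k), i <= k <= m ->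
    fcell (src i f) = src i (fcell f);
  ftgt : forall k i (f : cell C k), i <= k <= m ->
    fcell (tgt i f) = tgt i (fcell f);
  fone : forall k j (f : cell C k), k <= j <= m ->
    fcell (one j f) = one j (fcell f);
  fcomp : forall k i (f g : cell C k), i < k <= m -> tgt i f = src i g ->
    fcell (comp i f g) = comp i (fcell f) (fcell g) }.


Section FunctorContext.
Variables (m : nat) (C D : ncat m) (F : functor C D).

Fixpoint fexpr (t : expr C m) : expr D m :=
  match t with
  | Cell c => Cell (F m c)
  | Var => Var D m
  | Comp i t1 t2 => Comp i (fexpr t1) (fexpr t2)
  end.

Lemma occ_fexpr t : occ (fexpr t) = occ t.
Proof. by elim: t => //= i t1 -> t2 ->. Qed.

Lemma subst_fexpr t' t : subst (fexpr t') (fexpr t) = fexpr (subst t' t).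
Proof. by elim: t' => //= i t1 -> t2 ->. Qed.

Section At.
Variable f : cell C m.
Let bf := bdry m f.
Let bFf := bdry m (F m f).

Lemma fexpr_wf_ev t : wf bf t ->
  wf bFf (fexpr t) /\ ev (fexpr t) (F m f) = F m (ev t f).
Proof.
have wfE := wf_comp (ncatP _) (leqnn m) (leqnn m) (erefl _).
elim: t => [c|//|i t1 IH1 t2 IH2].
  by move=> _ /=; rewrite !(oneK (ncatP _)).
move=> /wfE[/IH1[w1 e1] /IH2[w2 e2] im e]; split; last first.
  by rewrite /= e1 e2 fcomp ?im /=.
apply/wfE; split=> //; rewrite e1 e2.
by rewrite -fsrc ?(ltnW im) //= -ftgt ?(ltnW im) //= e.
Qed.

Lemma fexpr_wf t : wf bf t -> wf bFf (fexpr t).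
Proof. by case/fexpr_wf_ev. Qed.

Lemma fexpr_eqv t u : eqv bf t u -> eqv bFf (fexpr t) (fexpr u).
Proof.
have wfE := wf_comp (ncatP _) (leqnn m) (leqnn m) (erefl _).
elim=> {t u} [u|u v _|u v z _ + _|i u v u' v' _ + _|i c d w|i c u w|i c u w
  |i u v z w w'|i j u1 u2 u3 u4 ij w w'] /=.
- exact: eqv_refl.
- exact: eqv_sym.
- exact: eqv_trans.
- exact: eqv_comp.
- have w' := fexpr_wf w; move/wfE: w => /= [_ _ im].
  rewrite !(oneK (ncatP _)) // => e.
  by rewrite fcomp ?im /=; first exact: eqv_cell.
- have := fexpr_wf w; move/wfE: w => /= [_ _ im _].
  by rewrite fone ?(ltnW im) /=; first exact: eqv_1l.
- have := fexpr_wf w; move/wfE: w => /= [_ _ im _].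
  by rewrite fone ?(ltnW im) /=; first exact: eqv_1r.
- by apply: eqv_assoc; [apply: fexpr_wf w|apply: fexpr_wf w'].
- by apply: eqv_exch => //; [apply: fexpr_wf w|apply: fexpr_wf w'].
Qed.

End At.

Section Map.
Variables (f g : cell C m) (c : hom f g).

Fact fhom_wf : wf (bdry m (F m f)) (fexpr (hom_expr c)).
Proof. exact: fexpr_wf (hom_wf c). Qed.

Fact fhom_occ : occ (fexpr (hom_expr c)) = 1.
Proof. by rewrite occ_fexpr hom_occ. Qed.

Fact fhom_ev : ev (fexpr (hom_expr c)) (F m f) = F m g.
Proof. by have [_ ->] := fexpr_wf_ev (hom_wf c); rewrite hom_ev. Qed.

Definition fhom : hom (F m f) (F m g) := mk_hom fhom_wf fhom_occ fhom_ev.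

Lemma fhomE : eqv (bdry m (F m f)) (hom_expr fhom) (fexpr (hom_expr c)).
Proof. exact: mk_homE. Qed.

End Map.

Lemma fhom_id f : fhom (hom_id f) = hom_id (F m f).
Proof.
apply: hom_eqP; apply: eqv_trans (mk_homE _ _ _) _.
apply: eqv_trans (eqv_sym (mk_homE _ _ _)).
exact: (fexpr_eqv (mk_homE _ _ _)).
Qed.

Lemma fhom_comp f g h (c : hom f g) (d : hom g h) :
  fhom (hom_comp c d) = hom_comp (fhom c) (fhom d).
Proof.
apply: hom_eqP; apply: eqv_trans (mk_homE _ _ _) _.
apply: eqv_trans (eqv_sym (mk_homE _ _ _)).
apply: eqv_trans (fexpr_eqv (mk_homE _ _ _)) _; rewrite -subst_fexpr.
apply: eqv_trans (eqv_substl _ (eqv_sym (fhomE c))) _.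
exact: eqv_substr (hom_bdry _) (hom_wf _) (eqv_sym (fhomE d)).
Qed.

Definition ns_pullback (N : natural_system D) : natural_system C.
Proof.
refine (@NaturalSystem m C (fun f => N (F m f))
  (fun f g c => ns_map N (fhom c)) _ _).
- by move=> f a; rewrite fhom_id ns_map_id.
- by move=> f g h c d a; rewrite fhom_comp ns_map_comp.
Defined.

End FunctorContext.

(* [track_ncat m] is the type of track (m+1)-categories. *)
Record track_ncat (m : nat) := TrackNCat {
  track_cat :> ncat m.+1;
  track_inv : forall f : cell track_cat m.+1, exists g : cell track_cat m.+1,
    [/\ src m g = tgt m f, tgt m g = src m f,
        comp m f g = one m.+1 (src m f) & comp m g f = one m.+1 (tgt m f)] }.

Section Presented.
Variables (m : nat) (T : ncat m.+1).

(* The congruence on T_m generated by s(f) ~ t(f) for f an (m+1)-cell; it is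
   equality on cells of dimension other than m. *)
Inductive cong : forall k, cell T k -> cell T k -> Prop :=
| cong_gen (f : cell T m.+1) : cong (src m f) (tgt m f)
| cong_refl k (a : cell T k) : cong a a
| cong_sym k (a b : cell T k) : cong a b -> cong b a
| cong_trans k (a b c : cell T k) : cong a b -> cong b c -> cong a c
| cong_comp k i (a b a' b' : cell T k) : i < k <= m ->
    tgt i a = src i b -> tgt i a' = src i b' -> cong a a' -> cong b b' ->
    cong (comp i a b) (comp i a' b').

Definition cong_equiv k : equivalence (cell T k) :=
  Equivalence (@cong_refl k) (@cong_sym k) (@cong_trans k).

Let TP := trunc_subproof T.

Lemma cong_neq k (a b : cell T k) : k != m -> cong a b -> a = b.
Proof.
move=> km ab; elim: ab km => {k a b} //.
- by move=> f; rewrite eqxx.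
- by move=> k a b _ IH /IH.
- by move=> k a b c _ ab _ bc km; rewrite ab ?bc.
- by move=> k i a b a' b' _ _ _ _ ea _ eb km; rewrite ea ?eb.
Qed.

Lemma cong_bdry k i (a b : cell T k) : i < k <= m -> cong a b ->
  src i a = src i b /\ tgt i a = tgt i b.
Proof.
move=> ik ab; elim: ab i ik => {k a b} //.
- move=> f i im; have h : i < m <= m.+1 by lia.
  by rewrite (src_src (ncatP T)) // (src_tgt (ncatP T)) //
    (tgt_src (ncatP T)) // (tgt_tgt (ncatP T)).
- by move=> k a b _ IH i /IH[].
- by move=> k a b c _ ab _ bc i ik; case: (ab i ik) => -> ->; apply: bc.
- move=> k i a b a' b' ik e e' _ IHa _ IHb j jk.
  case: (IHa j jk) (IHb j jk) => [sa ta] [sb tb].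
  case: (ltngtP i j) => [ij|ji|ij].
  + have h : i < j <= k by lia.
    have km : k <= m by lia.
    by rewrite !(src_comp_gt TP) // !(tgt_comp_gt TP) // sa sb ta tb.
  + have h : j < i <= k by lia.
    have km : k <= m by lia.
    rewrite -!(src_src TP (comp i _ _) h) // !(src_comp TP) //.
    rewrite -!(tgt_tgt TP (comp i _ _) h) // !(tgt_comp TP) //.
    by rewrite !(src_src TP) // !(tgt_tgt TP).
  + by subst j; rewrite !(src_comp TP) // !(tgt_comp TP).
Qed.

Definition pcell k : Type := quot (cong_equiv k).
Definition pcls k (a : cell T k) : pcell k := cls (cong_equiv k) a.

Definition presented_data : globular := {|
  cell := pcell;
  src := fun k i q => pcls (src i (rep q));
  tgt := fun k i q => pcls (tgt i (rep q));
  one := fun k j q => pcls (one j (rep q));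
  comp := fun k i q r => pcls (comp i (rep q) (rep r)) |}.

Lemma pclsP k (a b : cell T k) : pcls a = pcls b <-> cong a b.
Proof. exact: (clsP (cong_equiv k)). Qed.

Lemma pcls_inj k (a b : cell T k) : k < m -> pcls a = pcls b -> a = b.
Proof. by move=> km /pclsP; apply: cong_neq; rewrite neq_ltn km. Qed.

Lemma rep_pcls k (a : cell T k) : cong (rep (pcls a)) a.
Proof. exact: (rep_cls (cong_equiv k)). Qed.

Lemma pcls_surj k (q : cell presented_data k) : exists a, q = pcls a.
Proof. by exists (rep q); rewrite /pcls repK. Qed.

Lemma pcls_src k i (a : cell T k) : i <= k <= m ->
  pcls (src i a) = src i (pcls a : cell presented_data k).
Proof.
case/andP; rewrite leq_eqVlt => /orP[/eqP -> km|ik km] /=; apply/pclsP.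
  by rewrite !(srcK TP) //; apply: cong_sym (rep_pcls a).
by have [-> _] := cong_bdry (introT andP (conj ik km)) (rep_pcls a); apply: cong_refl.
Qed.

Lemma pcls_tgt k i (a : cell T k) : i <= k <= m ->
  pcls (tgt i a) = tgt i (pcls a : cell presented_data k).
Proof.
case/andP; rewrite leq_eqVlt => /orP[/eqP -> km|ik km] /=; apply/pclsP.
  by rewrite !(tgtK TP) //; apply: cong_sym (rep_pcls a).
by have [_ ->] := cong_bdry (introT andP (conj ik km)) (rep_pcls a); apply: cong_refl.
Qed.

Lemma pcls_one k j (a : cell T k) : k <= j <= m ->
  pcls (one j a) = one j (pcls a : cell presented_data k).
Proof.
case/andP; rewrite leq_eqVlt => /orP[/eqP <- km|kj jm] /=; apply/pclsP.
  by rewrite !(oneK TP) //; apply: cong_sym (rep_pcls a).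
have -> : rep (pcls a) = a by apply: cong_neq (rep_pcls a); lia.
exact: cong_refl.
Qed.

Lemma pcls_comp k i (a b : cell T k) : i < k <= m -> tgt i a = src i b ->
  pcls (comp i a b) = comp i (pcls a : cell presented_data k) (pcls b).
Proof.
move=> ik e; apply/pclsP; apply: cong_comp => //; last 2 first.
- exact/cong_sym/rep_pcls.
- exact/cong_sym/rep_pcls.
have [_ ->] := cong_bdry ik (rep_pcls a).
by have [-> _] := cong_bdry ik (rep_pcls b).
Qed.

Lemma pcls_composable k i (a b : cell T k) : i < k <= m ->
  tgt i (pcls a : cell presented_data k) = src i (pcls b : cell presented_data k) ->
  tgt i a = src i b.
Proof.
move=> ik; rewrite -pcls_src -?pcls_tgt; try lia.
by apply: pcls_inj; lia.
Qed.

Fact presented_subproof : is_ncat m presented_data.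
Proof.
split.
- by move=> k q; have [a ->] := pcls_surj q => km; rewrite -pcls_src ?(srcK TP) ?leqnn.
- by move=> k q; have [a ->] := pcls_surj q => km; rewrite -pcls_tgt ?(tgtK TP) ?leqnn.
- move=> k i j q; have [a ->] := pcls_surj q => ij km.
  by rewrite -!pcls_src; try lia; rewrite (src_src TP).
- move=> k i j q; have [a ->] := pcls_surj q => ij km.
  by rewrite -!pcls_tgt -?pcls_src; try lia; rewrite (src_tgt TP).
- move=> k i j q; have [a ->] := pcls_surj q => ij km.
  by rewrite -!pcls_src -?pcls_tgt; try lia; rewrite (tgt_src TP).
- move=> k i j q; have [a ->] := pcls_surj q => ij km.
  by rewrite -!pcls_tgt; try lia; rewrite (tgt_tgt TP).
- by move=> k q; have [a ->] := pcls_surj q => km; rewrite -pcls_one ?(oneK TP) ?leqnn.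
- move=> k j l q; have [a ->] := pcls_surj q => kj lm.
  by rewrite -!pcls_one; try lia; rewrite (one_one TP).
- move=> k j q; have [a ->] := pcls_surj q => kj.
  by rewrite -pcls_one // -pcls_src ?(src_one TP).
- move=> k j q; have [a ->] := pcls_surj q => kj.
  by rewrite -pcls_one // -pcls_tgt ?(tgt_one TP).
- move=> k i q r; have [a ->] := pcls_surj q; have [b ->] := pcls_surj r.
  move=> ik /(pcls_composable ik) e; rewrite -pcls_comp // -!pcls_src; try lia.
  by rewrite (src_comp TP).
- move=> k i q r; have [a ->] := pcls_surj q; have [b ->] := pcls_surj r.
  move=> ik /(pcls_composable ik) e; rewrite -pcls_comp // -!pcls_tgt; try lia.
  by rewrite (tgt_comp TP).
- move=> k i j q r; have [a ->] := pcls_surj q; have [b ->] := pcls_surj r.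
  move=> ij km; have ik : i < k <= m by lia.
  move=> /(pcls_composable ik) e; rewrite -pcls_comp // -!pcls_src; try lia.
  have ij' : i < j <= m by lia.
  have e' : tgt i (src j a) = src i (src j b).
    by rewrite (tgt_src TP) ?(src_src TP).
  by rewrite -(pcls_comp ij' e') (src_comp_gt TP).
- move=> k i j q r; have [a ->] := pcls_surj q; have [b ->] := pcls_surj r.
  move=> ij km; have ik : i < k <= m by lia.
  move=> /(pcls_composable ik) e; rewrite -pcls_comp // -!pcls_tgt; try lia.
  have ij' : i < j <= m by lia.
  have e' : tgt i (tgt j a) = src i (tgt j b).
    by rewrite (tgt_tgt TP) ?(src_tgt TP).
  by rewrite -(pcls_comp ij' e') (tgt_comp_gt TP).
- move=> k i q; have [a ->] := pcls_surj q => ik.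
  have e : tgt i (one k (src i a)) = src i a by rewrite (tgt_one TP) //; lia.
  rewrite -pcls_src; last by lia.
  rewrite -pcls_one; last by lia.
  by rewrite -(pcls_comp ik e) (comp1l TP).
- move=> k i q; have [a ->] := pcls_surj q => ik.
  have e : tgt i a = src i (one k (tgt i a)) by rewrite (src_one TP) //; lia.
  rewrite -pcls_tgt; last by lia.
  rewrite -pcls_one; last by lia.
  by rewrite -(pcls_comp ik e) (comp1r TP).
- move=> k i j q r; have [a ->] := pcls_surj q; have [b ->] := pcls_surj r.
  move=> ik jm; have ik' : i < k <= m by lia.
  move=> /(pcls_composable ik') e; have ij : i < j <= m by lia.
  have kj : k <= j <= m by lia.
  have ikk : i <= k <= j by lia.
  rewrite -pcls_comp // -!pcls_one // -pcls_comp ?(one_comp TP) //.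
  have h : k <= j <= m by lia.
  have h' : i < k <= j by lia.
  have st c : src i (one j c) = src i (c : cell T k) /\
              tgt i (one j c) = tgt i c.
    by rewrite -(src_src TP _ h') // -(tgt_tgt TP _ h') // (src_one TP) //
      (tgt_one TP).
  by have [_ ->] := st a; have [-> _] := st b.
- move=> k i p q r; have [a ->] := pcls_surj p; have [b ->] := pcls_surj q.
  have [c ->] := pcls_surj r.
  move=> ik /(pcls_composable ik) e /(pcls_composable ik) e'.
  rewrite -(pcls_comp ik e) -(pcls_comp ik e') -!pcls_comp ?(src_comp TP) //.
    by rewrite (compA TP).
  by rewrite (tgt_comp TP).
- move=> k i j p q r s; have [a ->] := pcls_surj p; have [b ->] := pcls_surj q.
  have [c ->] := pcls_surj r; have [d ->] := pcls_surj s.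
  move=> ij km; have ik : i < k <= m by lia.
  have jk : j < k <= m by lia.
  have ij' : i < j <= k by lia.
  move=> /(pcls_composable ik) e1 /(pcls_composable ik) e2.
  move=> /(pcls_composable jk) e3 /(pcls_composable jk) e4.
  rewrite -(pcls_comp ik e1) -(pcls_comp ik e2) -(pcls_comp jk e3) -(pcls_comp jk e4).
  have f1 : tgt j (comp i a b) = src j (comp i c d).
    by rewrite (tgt_comp_gt TP) // (src_comp_gt TP) // e3 e4.
  have f2 : tgt i (comp j a c) = src i (comp j b d).
    rewrite -(tgt_tgt TP (comp j a c) ij') // (tgt_comp TP) //.
    rewrite -(src_src TP (comp j b d) ij') // (src_comp TP) //.
    by rewrite (tgt_tgt TP) // (src_src TP) // -(src_tgt TP b ij') // e4
      (src_src TP).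
  by rewrite -(pcls_comp jk f1) -(pcls_comp ik f2) (exchange TP) // ij; lia.
Qed.

Definition presented : ncat m := NCat presented_subproof.

Definition presented_proj : functor (trunc T) presented :=
  @Functor m (trunc T) presented pcls pcls_src pcls_tgt pcls_one pcls_comp.

End Presented.

Record closed_cell m (T : ncat m.+1) (u : cell T m) := ClosedCell {
  closed_val :> cell T m.+1;
  closed_src : src m closed_val = u;
  closed_tgt : tgt m closed_val = u }.

HB.instance Definition _ m (T : ncat m.+1) (u : cell T m) :=
  Choice.copy (closed_cell u) {classic closed_cell u}.

Lemma closed_inj m (T : ncat m.+1) (u : cell T m) :
  injective (@closed_val m T u).
Proof.
by case=> [f fs ft] [g gs gt] /= e; subst g; congr ClosedCell; apply: Prop_irrelevance.
Qed.

Lemma bdry_closed m (T : ncat m.+1) (u : cell T m) (f : closed_cell u) :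
  bdry m (closed_val f) = bdry m u.
Proof.
case: m T u f => //= p T u f; have h : p < p.+1 <= p.+2 by lia.
rewrite -(src_src (ncatP T) _ h) // closed_src.
by rewrite -(tgt_tgt (ncatP T) _ h) // closed_tgt.
Qed.

Section Aut.
Variables (m : nat) (T : track_ncat m) (u : cell T m).
Let TP := ncatP T.

Let mm : m < m.+1 <= m.+1. Proof. lia. Qed.
Let mm1 : m <= m.+1 <= m.+1. Proof. lia. Qed.

Let closed_composable (f g : closed_cell u) : tgt m f = src m g.
Proof. by rewrite closed_tgt closed_src. Qed.

Definition aut_mul (f g : closed_cell u) : closed_cell u :=
  ClosedCell
    (etrans (src_comp TP mm (closed_composable f g)) (closed_src f))
    (etrans (tgt_comp TP mm (closed_composable f g)) (closed_tgt g)).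

Definition aut_one : closed_cell u :=
  ClosedCell (src_one TP u mm1) (tgt_one TP u mm1).

Let invP (f : cell T m.+1) := svalP (cid (track_inv f)).

Fact aut_inv_src (f : closed_cell u) : src m (sval (cid (track_inv f))) = u.
Proof. by have [-> _ _ _] := invP f; rewrite closed_tgt. Qed.

Fact aut_inv_tgt (f : closed_cell u) : tgt m (sval (cid (track_inv f))) = u.
Proof. by have [_ -> _ _] := invP f; rewrite closed_src. Qed.

Definition aut_inv (f : closed_cell u) : closed_cell u :=
  ClosedCell (aut_inv_src f) (aut_inv_tgt f).

Fact aut_mulA : associative aut_mul.
Proof. by move=> f g h; apply: closed_inj; rewrite /= (compA TP). Qed.

Fact aut_mul1g : left_id aut_one aut_mul.
Proof.
move=> f; apply: closed_inj => /=; rewrite -{1}(closed_src f).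
by rewrite (comp1l TP).
Qed.

Fact aut_mulg1 : right_id aut_one aut_mul.
Proof.
move=> f; apply: closed_inj => /=; rewrite -{2}(closed_tgt f).
by rewrite (comp1r TP).
Qed.

Fact aut_mulVg : left_inverse aut_one aut_inv aut_mul.
Proof.
move=> f; apply: closed_inj => /=.
by have [_ _ _ ->] := invP f; rewrite closed_tgt.
Qed.

Fact aut_mulgV : right_inverse aut_one aut_inv aut_mul.
Proof.
move=> f; apply: closed_inj => /=.
by have [_ _ -> _] := invP f; rewrite closed_src.
Qed.

End Aut.

HB.instance Definition _ m (T : track_ncat m) (u : cell T m) :=
  isGroup.Build (closed_cell u) (@aut_mulA m T u) (@aut_mul1g m T u)
    (@aut_mulg1 m T u) (@aut_mulVg m T u) (@aut_mulgV m T u).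

Definition Aut m (T : track_ncat m) (u : cell T m) : groupType := closed_cell u.

Section AutSystem.
Variables (m : nat) (T : track_ncat m).
Let TP := ncatP T.

Section Whisker.
Variables (u v : cell T m) (c : @hom m (trunc T) u v).

(* C[f], for f a closed cell with base u. *)
Fact whisker_src (f : Aut u) : src m (ev (hom_expr c) (closed_val f)) = v.
Proof.
rewrite (src_ev TP (ltnSn m) (bdry_closed f) (hom_wf c)) closed_src.
exact: (hom_ev c).
Qed.

Fact whisker_tgt (f : Aut u) : tgt m (ev (hom_expr c) (closed_val f)) = v.
Proof.
rewrite (tgt_ev TP (ltnSn m) (bdry_closed f) (hom_wf c)) closed_tgt.
exact: (hom_ev c).
Qed.

Definition whisker (f : Aut u) : Aut v :=
  ClosedCell (whisker_src f) (whisker_tgt f).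

Fact whiskerM : {morph whisker : f g / (f * g)%g}.
Proof.
move=> f g; apply: closed_inj => /=.
apply: (ev_comp TP (ltnSn m) (bdry_closed f) (bdry_closed g) _ (hom_wf c)).
by rewrite closed_tgt closed_src.
Qed.

HB.instance Definition _ := isMultiplicative.Build (Aut u) (Aut v) whisker whiskerM.

End Whisker.

Definition aut_system : natural_system (trunc T).
Proof.
refine (@NaturalSystem m (trunc T) (@Aut m T)
  (fun u v c => whisker c : {multiplicative _ -> _}) _ _).
- move=> u f; apply: closed_inj.
  have [_ e] := eqv_ev TP (leqnSn m) (leqnn m.+1) (bdry_closed f)
    (hom_idE (C := trunc T) u).
  exact: e (hom_wf (C := trunc T) _).
- move=> u v w c d f; apply: closed_inj.
  have [_ e] := eqv_ev TP (leqnSn m) (leqnn m.+1) (bdry_closed f) (hom_compE c d).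
  by rewrite [LHS](e (hom_wf (C := trunc T) _)) ev_subst.
Defined.

End AutSystem.

Definition abelian_track m (T : track_ncat m) : Prop :=
  forall u : cell T m, abelian_group (Aut u).

Definition hat m (T : track_ncat m) (D : natural_system (presented T)) :
  natural_system (trunc T) := ns_pullback (presented_proj T) D.

Definition linear_track m (T : track_ncat m) : Prop :=
  exists D : natural_system (presented T),
    abelian_natural_system D /\ inhabited (ns_iso (hat D) (aut_system T)).

(* Main.v *)
From HB Require Import structures.
From mathcomp Require Import all_boot.
From mathcomp Require Import zify boolp.
Require Import Defs.

Set Implicit Arguments.
Unset Strict Implicit.
Unset Printing Implicit Defensive.

(** If Aut is isomorphic to a pullback of an abelian natural system, then each
    Aut u is isomorphic to an abelian group, which settles one implication.

    For the converse, let T be abelian, of dimension m+1.  As (m+1)-cells can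
    be composed in all directions and inverted, two m-cells u and v are
    identified in the presented m-category exactly when some (m+1)-cell
    f : u -> v exists ([cong_connected]).  Conjugation g |-> f^-1 g f is then
    an isomorphism Aut u -> Aut v.  Another choice of f changes it by an inner
    automorphism of Aut v, hence not at all, since Aut v is abelian.  So
    all the groups Aut u, for u in one class q, are canonically identified,
    and the natural system Pi(T) takes the value Aut (rep q) at q.

    A context c of the presented category is lifted to T by choosing
    representatives of its m-cells; whiskering with the lift, followed by
    conjugation to the chosen base, gives Pi(T)_c.  What has to be shown is
    that the result does not depend on the lift and is functorial.  All such
    statements go through one relation on closed (m+1)-cells, conjugacy by an
    arbitrary (m+1)-cell ([conjugate]):
    - conjugacy is an equivalence and is compatible with i-composition for
      i < m, by the exchange law ([conjugate_comp]);
    - hence lifts of equal contexts send a closed cell to conjugate closed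
      cells ([conjugate_lift]);
    - when T is abelian, two conjugate closed cells with the same base are
      equal ([conjugate_inj]).
    The third point turns the conjugacies into the equations required of a
    natural system and of the isomorphism between its pullback and Aut. *)

(** * Conjugacy of closed cells *)

Section Conjugacy.
Variables (m : nat) (T : track_ncat m).
Let TP := ncatP T.
Let mm : m < m.+1 <= m.+1. Proof. lia. Qed.
Let mm1 : m <= m.+1 <= m.+1. Proof. lia. Qed.

Lemma comp_idl a (f : cell T m.+1) : src m f = a -> comp m (one m.+1 a) f = f.
Proof. by move=> <-; rewrite (comp1l TP). Qed.

Lemma comp_idr a (f : cell T m.+1) : tgt m f = a -> comp m f (one m.+1 a) = f.
Proof. by move=> <-; rewrite (comp1r TP). Qed.

Lemma src_tgt_congr i (f g : cell T m.+1) : i < m -> src m f = src m g ->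
  src i f = src i g /\ tgt i f = tgt i g.
Proof.
move=> im e; have h : i < m <= m.+1 by lia.
by rewrite -(src_src TP f h) // -(src_src TP g h) // -(tgt_src TP f h) //
  -(tgt_src TP g h) // e.
Qed.

(** The relation of being joined by an (m+1)-cell is already a congruence: inverses
    give symmetry, composites along m transitivity, and composites along i < m
    compatibility with composition.  The dimension k is kept general because it
    is an index of [cong], on which the proof is an induction. *)
Lemma cong_connected k (a b : cell T k) : cong a b -> k = m ->
  exists f : cell T m.+1, src k f = a /\ tgt k f = b.
Proof.
elim=> {k a b}
  [f|k a|k a b _ IH|k a b c _ IHa _ IHb|k i a b a' b' ik e e' _ IHa _ IHb] km.
- by exists f.
- by subst k; exists (one m.+1 a); rewrite (src_one TP) ?(tgt_one TP).
- have [f [fa fb]] := IH km; subst k; have [f' [sf tf _ _]] := track_inv f.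
  by exists f'; rewrite sf tf.
- have [f [fa fb]] := IHa km; have [g [gb gc]] := IHb km; subst k.
  by exists (comp m f g); rewrite (src_comp TP) ?(tgt_comp TP) // fb.
- have [f [fa fb]] := IHa km; have [g [gb gc]] := IHb km; subst k.
  have im : i < m <= m.+1 by lia.
  have fg : tgt i f = src i g.
    by rewrite -(tgt_src TP f im) // -(src_src TP g im) // fa gb.
  by exists (comp i f g); rewrite (src_comp_gt TP) ?(tgt_comp_gt TP) // ?fa ?fb
    ?gb ?gc //; lia.
Qed.

Lemma cong_parallel (a b : cell T m) : cong a b -> bdry m a = bdry m b.
Proof.
move=> ab; have cb i : i < m -> src i a = src i b /\ tgt i a = tgt i b.
  by move=> im; apply: (cong_bdry (T := T)) ab; lia.
have bd k : k <= m -> bdry k a = bdry k b by case: k => //= p /cb[-> ->].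
exact: bd.
Qed.

(** The closedness of g and h is part of the relation, while their bases are
    left free: whiskered cells whose bases are only provably equal can then be
    compared without transporting them along equalities of m-cells. *)
Definition conjugate (g h : cell T m.+1) : Prop :=
  exists f : cell T m.+1,
    [/\ src m f = src m g /\ src m f = tgt m g,
        tgt m f = src m h /\ tgt m f = tgt m h &
        comp m g f = comp m f h].

Lemma conjugate_refl g : src m g = tgt m g -> conjugate g g.
Proof.
move=> e; exists (one m.+1 (src m g)).
rewrite (src_one TP) ?(tgt_one TP) ?(comp1l TP) //; split=> //.
by rewrite e (comp1r TP).
Qed.

Lemma conjugate_closed u (g : Aut u) : conjugate (closed_val g) (closed_val g).
Proof. by apply: conjugate_refl; rewrite closed_src closed_tgt. Qed.

Lemma conjugate_sym g h : conjugate g h -> conjugate h g.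
Proof.
move=> [f [[sg tg] [sh th] e]]; have [f' [sf tf ff' f'f]] := track_inv f.
exists f'; rewrite sf tf; split=> //.
have fh : comp m f' (comp m f h) = h.
  by rewrite -(compA TP) ?f'f ?comp_idl.
have gf : comp m (comp m g f) f' = g.
  by rewrite (compA TP) ?ff' ?comp_idr.
rewrite -{1}fh -e (compA TP) ?gf ?(tgt_comp TP) ?(src_comp TP) //.
by rewrite -sg.
Qed.

Lemma conjugate_trans g h k : conjugate g h -> conjugate h k -> conjugate g k.
Proof.
move=> [f [[sg tg] [sh th] e]] [f' [[sg' tg'] [sh' th'] e']].
have ff' : tgt m f = src m f' by rewrite sh.
exists (comp m f f'); rewrite (src_comp TP) ?(tgt_comp TP) //; split=> //.
by rewrite -(compA TP) // e (compA TP) ?e' ?(compA TP) // -th.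
Qed.

(** Whiskering turns the m-cells of a context into identities; replacing such
    an m-cell by a congruent one is thus a conjugacy of identities. *)
Lemma conjugate_one (a b : cell T m) : cong a b ->
  conjugate (one m.+1 a) (one m.+1 b).
Proof.
move=> /cong_connected /(_ erefl) [f [fa fb]]; exists f.
rewrite !(src_one TP) ?(tgt_one TP) //; split=> //.
by rewrite comp_idl ?comp_idr.
Qed.

Lemma conjugate_bdry i g h : i < m -> conjugate g h ->
  src i g = src i h /\ tgt i g = tgt i h.
Proof.
move=> im [f [[sg _] [sh _] _]]; have h' : i < m <= m.+1 by lia.
have [<- <-] := src_tgt_congr im sg.
rewrite -(src_src TP h h') // -(tgt_src TP h h') // -sh.
by rewrite (src_tgt TP) ?(tgt_tgt TP).
Qed.

(** If f1 conjugates g1 to h1 and f2 conjugates g2 to h2, then the i-composite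
    of f1 and f2 conjugates the i-composites: apply the exchange law on both
    sides.  That f1 and f2 are i-composable follows from i < m, since their
    i-boundaries are those of their m-sources. *)
Lemma conjugate_comp i g1 g2 h1 h2 : i < m ->
  tgt i g1 = src i g2 -> conjugate g1 h1 -> conjugate g2 h2 ->
  conjugate (comp i g1 g2) (comp i h1 h2).
Proof.
move=> im g12 c1 c2; have [_ t1] := conjugate_bdry im c1.
have [s2 _] := conjugate_bdry im c2.
move: c1 c2 => [f1 [[sg1 tg1] [sh1 th1] e1]]
  [f2 [[sg2 tg2] [sh2 th2] e2]].
have [sf1 tf1] := src_tgt_congr im sg1.
have [sf2 tf2] := src_tgt_congr im sg2.
have f12 : tgt i f1 = src i f2 by rewrite tf1 sf2.
have h12 : tgt i h1 = src i h2 by rewrite -t1 -s2.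
exists (comp i f1 f2).
rewrite !(src_comp_gt TP) ?(tgt_comp_gt TP) -?sg1 -?sg2 -?tg1 -?tg2 -?sh1 -?sh2
  -?th1 -?th2 //; try lia.
split=> //.
have imm : i < m < m.+1 by lia.
rewrite (exchange TP imm) -?sg1 -?sg2 -?tg1 -?tg2 // e1 e2.
by rewrite (exchange TP imm) -?sh1 -?sh2 -?th1 -?th2.
Qed.

(** The only place where commutativity is used: h and h' are conjugate to each
    other by an (m+1)-cell which is itself closed with base u. *)
Lemma conjugate_inj g u (h h' : Aut u) : abelian_group (Aut u) ->
  conjugate g (closed_val h) -> conjugate g (closed_val h') -> h = h'.
Proof.
move=> ab /conjugate_sym gh /(conjugate_trans gh) [f [[+ _] [+ _] e]].
rewrite !closed_src => sf tf.
have {e} : (h * ClosedCell sf tf)%g = (ClosedCell sf tf * h')%g :> Aut u.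
  exact: closed_inj.
rewrite (ab h); exact: mulgI.
Qed.

Lemma conjugate_ev x (t : expr T m) (g h : cell T m.+1) :
  bdry m g = x -> wf x t -> conjugate g h -> conjugate (ev t g) (ev t h).
Proof.
move=> gx + gh; elim: t => [c|//|i t1 IH1 t2 IH2] /=.
  by move=> _; apply/conjugate_one/cong_refl.
move=> /(wf_comp TP (leqnSn m) (leqnn _) gx)[/IH1 c1 /IH2 c2 im e].
exact: conjugate_comp.
Qed.

(** Conjugation by a chosen (m+1)-cell from u to v. *)
Section Transport.
Variables (u v : cell T m) (uv : cong u v).

Let f := sval (cid (cong_connected uv erefl)).
Let f' := sval (cid (track_inv f)).
Let fP : src m f = u /\ tgt m f = v := svalP (cid (cong_connected uv erefl)).
Let f'P := svalP (cid (track_inv f)).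

Fact transport_src (g : Aut u) :
  src m (comp m f' (comp m (closed_val g) f)) = v.
Proof.
have [fu fv] := fP; have [sf tf _ _] := f'P.
by rewrite !(src_comp TP) ?sf ?tf ?closed_src ?closed_tgt ?fu.
Qed.

Fact transport_tgt (g : Aut u) :
  tgt m (comp m f' (comp m (closed_val g) f)) = v.
Proof.
have [fu fv] := fP; have [sf tf _ _] := f'P.
by rewrite !(tgt_comp TP) ?(src_comp TP) ?tf ?closed_src ?closed_tgt ?fu.
Qed.

Definition transport (g : Aut u) : Aut v :=
  ClosedCell (transport_src g) (transport_tgt g).

Lemma conjugate_transport (g : Aut u) :
  conjugate (closed_val g) (closed_val (transport g)).
Proof.
have [fu fv] := fP; have [sf tf ff' _] := f'P.
exists f; rewrite !closed_src !closed_tgt; split=> //=.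
have gf : tgt m (closed_val g) = src m f by rewrite closed_tgt.
have f'g : tgt m f' = src m (closed_val g) by rewrite tf closed_src.
rewrite -(compA TP) ?(src_comp TP) // ff' comp_idl // (src_comp TP) //.
by rewrite -f'g.
Qed.

Fact transportM : {morph transport : g h / (g * h)%g}.
Proof.
move=> g h; apply: closed_inj => /=.
have [fu fv] := fP; have [sf tf ff' _] := f'P.
have gf : tgt m (closed_val g) = src m f by rewrite closed_tgt.
have hf : tgt m (closed_val h) = src m f by rewrite closed_tgt.
have gh : tgt m (closed_val g) = src m (closed_val h).
  by rewrite closed_tgt closed_src.
have f'g : tgt m f' = src m (closed_val g) by rewrite tf closed_src.
have f'h : tgt m f' = src m (closed_val h) by rewrite tf closed_src.
have ff'' : tgt m f = src m f' by rewrite sf.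
have ff'gf : comp m f (comp m f' (comp m (closed_val h) f))
    = comp m (closed_val h) f.
  by rewrite -(compA TP) ?(src_comp TP) // ff' comp_idl // (src_comp TP) // -f'h.
rewrite (compA TP mm gh) //.
rewrite [RHS](compA TP) ?(src_comp TP) ?(tgt_comp TP) -?f'h ?sf //.
by rewrite (compA TP mm gf) ?ff'gf ?(src_comp TP) // -?f'h.
Qed.

End Transport.

HB.instance Definition _ u v (uv : cong u v) :=
  isMultiplicative.Build (Aut u) (Aut v) (transport uv) (transportM uv).

(** Transport along a chosen cell v -> u is inverse to transport along a chosen
    cell u -> v, although the two cells need not be inverse to each other. *)
Lemma transport_bij u v (uv : cong u v) :
  abelian_track T -> bijective (transport uv).
Proof.
move=> ab; exists (transport (cong_sym uv)) => g.
all: apply: (conjugate_inj (ab _) (conjugate_transport _ _)).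
all: exact/conjugate_sym/conjugate_transport.
Qed.

End Conjugacy.

(** * Lifting contexts from the presented category *)

Section Lift.
Variables (m : nat) (T : track_ncat m).
Let P := presented T.
Let TP := ncatP T.
Let TP' : is_ncat m T := trunc_subproof T.

Fixpoint lift (t : expr P m) : expr T m :=
  match t with
  | Cell q => Cell (rep q)
  | Var => Var T m
  | Comp i t1 t2 => Comp i (lift t1) (lift t2)
  end.

Lemma occ_lift t : occ (lift t) = occ t.
Proof. by elim: t => //= i t1 -> t2 ->. Qed.

Lemma lift_subst t' t : lift (subst t' t) = subst (lift t') (lift t).
Proof. by elim: t' => //= i t1 -> t2 ->. Qed.

Section At.
Variables (u : cell T m) (q : cell P m) (uq : pcls u = q).

(** Composability can be lifted because composites are taken along i < m, where
    the quotient map is injective on cells; this needs to be proved together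
    with the value of the lifted expression. *)
Lemma lift_wf_ev t : wf (bdry m q) t ->
  wf (bdry m u) (lift t) /\ pcls (ev (lift t) u) = ev t q.
Proof.
have wfE := wf_comp (ncatP P) (leqnn m) (leqnn m) (erefl (bdry m q)).
have wfE' := wf_comp TP' (leqnn m) (leqnn m) (erefl (bdry m u)).
elim: t => [//|//|i t1 IH1 t2 IH2].
move=> /wfE[/IH1[w1 e1] /IH2[w2 e2] im].
have im' : i < m <= m by rewrite im /=.
rewrite -e1 -e2 => /(pcls_composable im') e; split; first exact/wfE'.
by rewrite /= pcls_comp // e1 e2.
Qed.

Lemma lift_wf t : wf (bdry m q) t -> wf (bdry m u) (lift t).
Proof. by case/lift_wf_ev. Qed.

(** Independence of the lift.  The associativity and exchange rules lift to the
    same rules in T, hence to equalities.  The rules that compute with m-cells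
    hold after lifting only up to the choice of representatives, that is, up to
    congruent m-cells, hence up to conjugacy. *)
Lemma conjugate_lift t t' (g : Aut u) :
  eqv (bdry m q) t t' -> wf (bdry m q) t ->
  conjugate (ev (lift t) (closed_val g)) (ev (lift t') (closed_val g)).
Proof.
have gu := bdry_closed g.
have wfT := wf_comp TP (leqnSn m) (leqnn _) gu.
have refl s : wf (bdry m q) s ->
    conjugate (ev (lift s) (closed_val g)) (ev (lift s) (closed_val g)).
  move=> /lift_wf ws; apply: conjugate_refl.
  by rewrite (src_ev TP (ltnSn m) gu) // (tgt_ev TP (ltnSn m) gu) //
    closed_src closed_tgt.
have eqvT s s' : eqv (bdry m u) s s' -> wf (bdry m u) s ->
    ev s (closed_val g) = ev s' (closed_val g).
  by move=> /(eqv_ev TP (leqnSn m) (leqnn _) gu)[].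
have wfP s s' : eqv (bdry m q) s s' -> wf (bdry m q) s <-> wf (bdry m q) s'.
  by move=> /(eqv_ev (ncatP P) (leqnn m) (leqnn m) (erefl _))[].
elim=> {t t'} [t|t t' /wfP w IH|t t' t'' /wfP w IH _ IH'
  |i t1 t2 u1 u2 _ IH1 _ IH2|i c d w|i c t w|i c t w|i t1 t2 t3 w w'|i j t1 t2 t3 t4 ij w w'].
- exact: refl.
- by move=> wt; apply/conjugate_sym/IH/w.
- by move=> wt; apply: conjugate_trans (IH wt) (IH' _); apply/w.
- move=> wt; have /wfT[_ _ im e] := lift_wf wt; case: wt => /IH1 c1 /IH2 c2 _.
  exact: conjugate_comp.
- move=> _; rewrite (eqvT _ _ (eqv_cell (lift_wf w)) (lift_wf w)).
  move/wfT: (lift_wf w) => [_ _ im _]; apply: conjugate_one.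
  exact/cong_sym/rep_pcls.
- move=> _; have /wfT[_ wt im e] := lift_wf w; have [_ /refl ct _] := w.
  (* The representative of an identity need not be an identity: the unit rule
     of T applies only after replacing it by the congruent cell c'. *)
  pose c' : expr T m := Cell (one m (rep c)).
  have cc' : conjugate (one m.+1 (rep (one m c))) (ev c' (closed_val g)).
    exact/conjugate_one/rep_pcls.
  have w' : wf (bdry m u) (Comp i c' (lift t)).
    by apply/wfT; split=> //; have [_ <-] := conjugate_bdry im cc'.
  rewrite -(eqvT _ _ (eqv_1l w') w').
  exact: conjugate_comp.
- move=> _; have /wfT[wt _ im e] := lift_wf w; have [/refl ct _ _] := w.
  pose c' : expr T m := Cell (one m (rep c)).
  have cc' : conjugate (one m.+1 (rep (one m c))) (ev c' (closed_val g)).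
    exact/conjugate_one/rep_pcls.
  have w' : wf (bdry m u) (Comp i (lift t) c').
    by apply/wfT; split=> //; have [<- _] := conjugate_bdry im cc'.
  rewrite -(eqvT _ _ (eqv_1r w') w').
  exact: conjugate_comp.
- move=> _; rewrite (eqvT _ _ (eqv_assoc (lift_wf w) (lift_wf w')) (lift_wf w)).
  exact: (refl _ w').
- move=> _; rewrite (eqvT _ _ (eqv_exch ij (lift_wf w) (lift_wf w')) (lift_wf w)).
  exact: (refl _ w').
Qed.

End At.

(** Projecting a context of T and lifting it back only replaces its m-cells by
    congruent ones.  This is the source of the naturality of the isomorphism
    with Aut. *)
Lemma conjugate_lift_fexpr t u (g : Aut u) : wf (bdry m u) t ->
  conjugate (ev (lift (fexpr (presented_proj T) t)) (closed_val g))
            (ev t (closed_val g)).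
Proof.
elim: t => [c|_|i t1 IH1 t2 IH2] /=.
- by move=> _; apply/conjugate_one/rep_pcls.
- exact: conjugate_closed.
move=> w; move/(wf_comp TP (leqnSn m) (leqnn _) (bdry_closed g)): (w).
move=> [/IH1 c1 /IH2 c2 im _].
have := lift_wf (erefl (pcls u))
  (@fexpr_wf _ _ _ (presented_proj T) u (Comp i t1 t2) w).
move=> /(wf_comp TP (leqnSn m) (leqnn _) (bdry_closed g))[_ _ _ e].
exact: conjugate_comp.
Qed.

(** * The natural system on the presented category *)

Section Action.
Variables (q r : cell P m) (c : hom q r).

Let a : cell T m := ev (lift (hom_expr c)) (rep q).
Let liftP := lift_wf_ev (repK q) (hom_wf c).

Fact lift_occ : occ (lift (hom_expr c)) = 1.
Proof. by rewrite occ_lift hom_occ. Qed.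

Definition lift_hom : @hom m (trunc T) (rep q) a :=
  @mk_hom m (trunc T) _ _ _ liftP.1 lift_occ (erefl a).

Fact lift_cong : cong a (rep r).
Proof. by apply/pclsP; rewrite liftP.2 hom_ev [RHS]repK. Qed.

Definition action : {multiplicative Aut (rep q) -> Aut (rep r)} :=
  transport lift_cong \o whisker lift_hom.

(** This determines the action among all maps when Aut (rep r) is abelian, so
    that neither the lift nor the cell chosen for the transport matters. *)
Lemma conjugate_action g :
  conjugate (ev (lift (hom_expr c)) (closed_val g)) (closed_val (action g)).
Proof.
have [_ e] := eqv_ev TP (leqnSn m) (leqnn _) (bdry_closed g)
  (mk_homE (C := trunc T) liftP.1 lift_occ (erefl a)).
rewrite -(e (hom_wf (C := trunc T) _)).
exact: (conjugate_transport lift_cong (whisker lift_hom g)).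
Qed.

End Action.

Hypothesis ab : abelian_track T.

(** The natural system Pi(T).  Each functoriality law is an equality of two
    elements of one group Aut, so it suffices to see that both are conjugate to
    the same whiskered cell. *)
Definition homotopy_system : natural_system P.
Proof.
refine (@NaturalSystem m P (fun q => Aut (rep q)) action _ _).
- move=> q g; apply: (conjugate_inj (@ab _) (conjugate_action _ _)).
  apply: conjugate_sym.
  exact: (conjugate_lift (repK q) g (eqv_sym (hom_idE q))).
- move=> q r s c d g; apply: (conjugate_inj (@ab _) (conjugate_action _ _)).
  apply: conjugate_trans (conjugate_lift (repK q) g (hom_compE c d) (hom_wf _)) _.
  rewrite lift_subst ev_subst; apply: conjugate_trans (conjugate_action _ _).
  apply/conjugate_sym/(conjugate_ev (bdry_closed _) (lift_wf (repK r) (hom_wf d))).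
  exact/conjugate_sym/conjugate_action.
Defined.

(** At u the isomorphism is the transport from the chosen representative of the
    class of u to u itself. *)
Lemma homotopy_system_iso : ns_iso (hat homotopy_system) (aut_system T).
Proof.
refine (@NsIso m (trunc T) (hat homotopy_system) (aut_system T)
  (fun u => transport (rep_pcls u) : {multiplicative _ -> _}) _ _).
- by move=> u; apply: transport_bij.
move=> u v c g /=; have gu := cong_parallel (rep_pcls u).
(* Both sides of the naturality square are conjugate to C[g], where C is the
   given context; its boundary agrees with that of g by gu. *)
apply: (conjugate_inj (@ab _)).
  apply: conjugate_trans (conjugate_transport _ _).
  apply: conjugate_trans (conjugate_action _ _).
  apply: conjugate_sym.
  apply: conjugate_trans (conjugate_lift (repK _) g (fhomE _ c) (hom_wf _)) _.
  by apply: conjugate_lift_fexpr; rewrite gu; apply: hom_wf.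
by apply: (conjugate_ev (etrans (bdry_closed g) gu) (hom_wf c));
  apply: conjugate_transport.
Qed.

End Lift.

Theorem theorem2p2p3 (m : nat) (T : track_ncat m) :
  abelian_track T <-> linear_track T.
Proof.
split=> [ab|[D [abD [phi]]] u a b].
  exists (homotopy_system ab); split; first by move=> q; apply: ab.
  by constructor; apply: homotopy_system_iso.
have [psi _ psiK] := ns_iso_bij phi u.
rewrite -(psiK a) -(psiK b); apply: gmulf_commute; exact: abD.
Qed.
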